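(* Let $\mathcal{R}$ be a partial order on a finite set $B$ and let $\mathcal{Q}$ be a subposet of $\mathcal{R}$. For $\lambda\in\mathrm{pp}_{\mathrm{nn}}(\mathcal{R})$, $$\mathrm{Res}^{\mathrm{UT}_{\mathcal{R}}}_{\mathrm{UT}_{\mathcal{Q}}}(\chi^\lambda)=\frac{1}{|\mathrm{UT}_{\lambda_{\mathcal{Q}}}/(\mathrm{UT}_\lambda\cap\mathrm{UT}_{\mathcal{Q}})|}\,\frac{\chi^\lambda(1)}{\chi^{\lambda_{\mathcal{Q}}}(1)}\sum_{\substack{\nu\in\mathrm{pp}_{\mathrm{nn}}(\mathcal{Q})\\ \mathrm{UT}_{\lambda_{\mathcal{Q}}}\supseteq\mathrm{UT}_\nu\supseteq\mathrm{UT}_\lambda\cap\mathrm{UT}_{\mathcal{Q}}}}\chi^\nu .$$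
   Context: Fix a finite field $\mathbb{F}_q$ with $q$ elements. For a partial order $\mathcal{R}$ on a finite set $B$, $\mathrm{Int}^\circ(\mathcal{R})=\{[i,j]\mid i\prec_{\mathcal{R}}j\}$, ordered by $[k,l]\preceq[i,j]$ iff $i\preceq_{\mathcal{R}}k$ and $l\preceq_{\mathcal{R}}j$; intervals are identified with pairs of endpoints. The pattern group is $\mathrm{UT}_{\mathcal{R}}=\{u:\{[i,j]\mid i\preceq_{\mathcal{R}}j\}\to\mathbb{F}_q\mid u([i,i])=1\}$ with product $(uv)([i,k])=\sum_{i\preceq_{\mathcal{R}}j\preceq_{\mathcal{R}}k}u([i,j])v([j,k])$. A subposet $\mathcal{Q}$ of $\mathcal{R}$ is a partial order on $B$ with $i\preceq_{\mathcal{Q}}j\Rightarrow i\preceq_{\mathcal{R}}j$; $\mathrm{UT}_{\mathcal{Q}}\subseteq\mathrm{UT}_{\mathcal{R}}$ via extension by zero. $\mathrm{NPtt}(\mathcal{R})=\{\mathrm{UT}_{\mathcal{P}}\triangleleft\mathrm{UT}_{\mathcal{R}}\mid\mathcal{P}\text{ a subposet of }\mathcal{R}\}$, ordered by inclusion. $\mathrm{pp}_{\mathrm{nn}}(\mathcal{R})$ is the set of antichains of $\mathrm{Int}^\circ(\mathcal{R})$. For $\lambda\in\mathrm{pp}_{\mathrm{nn}}(\mathcal{R})$: $\mathrm{UT}_\lambda\in\mathrm{NPtt}(\mathcal{R})$ is the subgroup of all $u\in\mathrm{UT}_{\mathcal{R}}$ with $u([k,l])=0$ whenever $[k,l]\in\mathrm{Int}^\circ(\mathcal{R})$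 satisfies $[k,l]\preceq[i,j]$ for some $[i,j]\in\lambda$. The supercharacter $\chi^\lambda=\sum_\psi\psi(1)\psi$ is summed over irreducible complex characters $\psi$ of $\mathrm{UT}_{\mathcal{R}}$ with $\mathrm{UT}_\lambda\subseteq\ker\psi$ and $O\not\subseteq\ker\psi$ for every cover $O$ of $\mathrm{UT}_\lambda$ in $\mathrm{NPtt}(\mathcal{R})$. For $\nu\in\mathrm{pp}_{\mathrm{nn}}(\mathcal{Q})$, $\mathrm{UT}_\nu$ and $\chi^\nu$ are the same constructions with $\mathcal{Q}$ in place of $\mathcal{R}$ (so $\mathrm{UT}_\nu\subseteq\mathrm{UT}_{\mathcal{Q}}$ and $\chi^\nu$ is a character of $\mathrm{UT}_{\mathcal{Q}}$). Set $\lambda_{\mathcal{Q}}=\{[i,j]\in\lambda\mid i\prec_{\mathcal{Q}}j\}\in\mathrm{pp}_{\mathrm{nn}}(\mathcal{Q})$; thus $\mathrm{UT}_{\lambda_{\mathcal{Q}}}$ and $\chi^{\lambda_{\mathcal{Q}}}$ are formed in $\mathrm{UT}_{\mathcal{Q}}$. *)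

(* Defs.v *)
From HB Require Import structures.
From mathcomp Require Import all_boot all_order all_fingroup all_algebra.
From mathcomp Require Import all_solvable all_field all_character.
Set Implicit Arguments.
Unset Strict Implicit.
Unset Printing Implicit Defensive.
Import GroupScope GRing.Theory.

(* Partial orders on B are reified as sets of pairs, so that the partial      *)
(* orders on B form a finite type, over which NPtt below ranges.              *)
Section Posets.
Variable B : finType.

Definition is_partial_order (P : {set B * B}) : bool :=
  [&& [forall i, (i, i) \in P],
      [forall i, forall j, ((i, j) \in P) && ((j, i) \in P) ==> (i == j)]
    & [forall i, forall j, forall k,
        ((i, j) \in P) && ((j, k) \in P) ==> ((i, k) \in P)]].

Record poset := Poset { graph :> {set B * B}; _ : is_partial_order graph }.

HB.instance Definition _ := [isSub for graph].
HB.instance Definition _ := [Finite of poset by <:].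

Implicit Types P Q : poset.

Definition ple P : rel B := fun i j => (i, j) \in (P : {set B * B}).
Definition plt P : rel B := fun i j => (i != j) && ple P i j.

Definition subposet P Q : bool := (P : {set B * B}) \subset Q.

Lemma ple_refl P : reflexive (ple P).
Proof. by case: P => P hP; rewrite /ple /=; case/and3P: hP => [/forallP h _ _] i; exact: h. Qed.

Lemma ple_anti P : antisymmetric (ple P).
Proof.
case: P => P hP; rewrite /ple /=; case/and3P: hP => [_ /forallP h _] i j hij.
by apply/eqP; exact: (implyP (forallP (h i) j)).
Qed.

Lemma ple_trans P : transitive (ple P).
Proof.
case: P => P hP; rewrite /ple /=; case/and3P: hP => [_ _ /forallP h] j i k hij hjk.
apply: (implyP (forallP (forallP (h i) j) k)).
by apply/andP; split.
Qed.

Lemma subposetP P Q : reflect (subrel (ple P) (ple Q)) (subposet P Q).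
Proof.
apply: (iffP subsetP) => h; first by move=> i j; apply: h.
by case=> i j; apply: h.
Qed.

(* An interval [i, j] is encoded by the pair (i, j) of its endpoints. *)
Definition Int0 P : {set B * B} := [set x | plt P x.1 x.2].

Definition ile P : rel (B * B) := fun x y => ple P y.1 x.1 && ple P x.2 y.2.

Definition ppnn P : {set {set B * B}} :=
  [set lam : {set B * B} | (lam \subset Int0 P) &&
     [forall x in lam, forall y in lam, ile P x y ==> (x == y)]].

Definition nnrestr Q (lam : {set B * B}) : {set B * B} := lam :&: Int0 Q.

Lemma nnrestr_ppnn P Q lam :
  subposet Q P -> lam \in ppnn P -> nnrestr Q lam \in ppnn Q.
Proof.
move=> /subposetP QP; rewrite !inE => /andP[_ /forall_inP anti].
rewrite subsetIr; apply/forall_inP=> x /setIP[xl _].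
apply/forall_inP=> y /setIP[yl _]; apply/implyP=> /andP[h1 h2].
by apply: (implyP (forall_inP (anti x xl) y yl)); rewrite /ile !QP.
Qed.

End Posets.

(* A function on {[i, j] | i <=_R j} is represented by its extension by zero  *)
(* to all pairs, so that UT_P, for a subposet P of R, is literally the        *)
(* subgroup UT P of ut F R defined below.                                     *)
Section PatternGroup.
Variables (F : finFieldType) (B : finType) (R : poset B).
Local Open Scope ring_scope.

Definition is_ut (u : {ffun B * B -> F}) : bool :=
  [forall i, u (i, i) == 1] &&
  [forall x, (x \notin (R : {set _})) ==> (u x == 0)].

Record ut := Ut { ut_val :> {ffun B * B -> F}; _ : is_ut ut_val }.

HB.instance Definition _ := [isSub for ut_val].
HB.instance Definition _ := [Finite of ut by <:].

Implicit Types u v w : ut.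

Lemma ut_diag u i : u (i, i) = 1.
Proof. by case: u => u hu /=; case/andP: hu => [/forallP h _]; apply/eqP. Qed.

Lemma ut_out u i j : ~~ ple R i j -> u (i, j) = 0.
Proof.
by case: u => u hu /=; case/andP: hu => [_ /forallP h] hij; apply/eqP/(implyP (h (i, j))).
Qed.

Lemma ut_ext u v : (forall i j, u (i, j) = v (i, j)) -> u = v.
Proof. by move=> h; apply/val_inj/ffunP=> -[i j]; apply: h. Qed.

Definition mul_fun u v : {ffun B * B -> F} :=
  [ffun x => \sum_(j | ple R x.1 j && ple R j x.2) u (x.1, j) * v (j, x.2)].

Definition one_fun : {ffun B * B -> F} := [ffun x => (x.1 == x.2)%:R].

Lemma mul_is_ut u v : is_ut (mul_fun u v).
Proof.
apply/andP; split.
  apply/forallP=> i; rewrite ffunE /= (big_pred1 i) ?ut_diag ?mulr1 //= => j.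
  apply/idP/eqP=> [/andP[h1 h2]|->]; last by rewrite ple_refl.
  by apply/(@ple_anti _ R); rewrite h1 h2.
apply/forallP=> -[i k]; apply/implyP=> hik.
rewrite ffunE /= big_pred0 // => j; apply: contraNF hik => /andP[h1 h2].
exact: (ple_trans h1 h2).
Qed.

Lemma one_is_ut : is_ut one_fun.
Proof.
apply/andP; split; first by apply/forallP=> i; rewrite ffunE eqxx.
apply/forallP=> -[i j]; apply/implyP; rewrite ffunE /=.
by have [->|//] := eqVneq i j; rewrite -/(ple R j j) ple_refl.
Qed.

Definition ut_mul u v : ut := Ut (mul_is_ut u v).
Definition ut_one : ut := Ut one_is_ut.

Lemma ut_mulE u v i k :
  ut_mul u v (i, k) = \sum_(j | ple R i j && ple R j k) u (i, j) * v (j, k).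
Proof. by rewrite ffunE. Qed.

Lemma ut_mulE_all u v i k : ut_mul u v (i, k) = \sum_j u (i, j) * v (j, k).
Proof.
rewrite ut_mulE big_mkcond; apply: eq_bigr => j _.
case: ifPn => //; rewrite negb_and.
by case/orP=> h; rewrite (ut_out _ h) ?mul0r ?mulr0.
Qed.

Lemma ut_mulA : associative ut_mul.
Proof.
move=> u v w; apply: ut_ext => i l; rewrite !ut_mulE_all.
under eq_bigr do rewrite ut_mulE_all mulr_sumr.
rewrite exchange_big /=; apply: eq_bigr => k _.
by rewrite ut_mulE_all mulr_suml; apply: eq_bigr => j _; rewrite mulrA.
Qed.

Lemma ut_mul1 : left_id ut_one ut_mul.
Proof.
move=> u; apply: ut_ext => i k; rewrite ut_mulE_all (bigD1 i) //= ffunE eqxx.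
rewrite mul1r big1 ?addr0 // => j; rewrite ffunE /= eq_sym.
by move/negPf->; rewrite mul0r.
Qed.

Lemma ut_mulI u : injective (ut_mul^~ u).
Proof.
move=> v w /= e; apply: ut_ext => i k.
have [n] := ubnP #|[set j | plt R j k]|; elim: n k => // n IHn k ltn.
move/(congr1 (fun x : ut => x (i, k))): e; rewrite !ut_mulE_all.
rewrite !(bigD1 (P := xpredT) k) //= !ut_diag !mulr1.
rewrite (eq_bigr (fun j => w (i, j) * u (j, k))) => [/addIr //|j jk].
have [hjk|hjk] := boolP (ple R j k); last by rewrite (ut_out _ hjk) !mulr0.
congr (_ * _); apply: IHn; rewrite -ltnS; apply: leq_trans ltn.
rewrite ltnS proper_card //.
apply/properP; split.
  apply/subsetP=> m; rewrite !inE => /andP[mj hmj].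
  rewrite /plt (ple_trans hmj hjk) andbT; apply: contraNneq mj => mk.
  by apply/eqP/(@ple_anti _ R); rewrite hmj mk.
by exists j; rewrite !inE /plt ?jk ?eqxx.
Qed.

Definition ut_inv u : ut := invF (@ut_mulI u) ut_one.

Lemma ut_mulV : left_inverse ut_one ut_inv ut_mul.
Proof. by move=> u; apply: (f_invF (@ut_mulI u)). Qed.

HB.instance Definition _ := Finite_isGroup.Build ut ut_mulA ut_mul1 ut_mulV.

End PatternGroup.

(* Everything below lives in the ambient group ut F R; P, Q range over        *)
(* partial orders on B, used only when they are subposets of R. The ambient   *)
(* UT_R is itself UT R = [set: ut F R].                                       *)
Section Supercharacters.
Variables (F : finFieldType) (B : finType) (R : poset B).
Implicit Types (P Q : poset B) (lam : {set B * B}).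
Local Open Scope ring_scope.

Definition UT Q : {set ut F R} :=
  [set u : ut F R | [forall x, (x \notin (Q : {set _})) ==> (u x == 0)]].

Lemma mem_UTP Q (u : ut F R) :
  reflect (forall i j, ~~ ple Q i j -> u (i, j) = 0) (u \in UT Q).
Proof.
rewrite inE; apply: (iffP forallP) => [h i j hij | h [i j]].
  by apply/eqP/(implyP (h (i, j))).
by apply/implyP=> hij; apply/eqP/h.
Qed.

Lemma UT_group_set Q : group_set (UT Q).
Proof.
apply/group_setP; split=> [|u v /mem_UTP hu /mem_UTP hv].
  apply/mem_UTP=> i j hij; rewrite ffunE /=.
  by case: eqVneq hij => // ->; rewrite ple_refl.
apply/mem_UTP=> i k hik; rewrite ut_mulE_all big1 // => j _.
have [hij|/hu->] := boolP (ple Q i j); last by rewrite mul0r.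
have [hjk|/hv->] := boolP (ple Q j k); last by rewrite mulr0.
by rewrite (ple_trans hij hjk) in hik.
Qed.

Canonical UT_group Q := Group (UT_group_set Q).

Lemma UT_ambient : UT R = [set: ut F R].
Proof. by apply/setP=> u; rewrite in_setT; apply/mem_UTP=> i j /ut_out. Qed.

Definition NPtt Q : {set {set ut F R}} :=
  [set UT P | P : poset B & subposet P Q && (UT P <| UT Q)].

Definition NPtt_cover Q (H O : {set ut F R}) : bool :=
  [&& O \in NPtt Q, H \proper O &
      [forall N in NPtt Q, ~~ ((H \proper N) && (N \proper O))]].

Definition UTnn Q lam : {set ut F R} :=
  [set u in UT Q | [forall x in Int0 Q,
     [exists y in lam, ile Q x y] ==> (u x == 0)]].

Lemma mem_UTnnP Q lam (u : ut F R) :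
  reflect (u \in UT Q /\ forall x y, x \in Int0 Q -> y \in lam -> ile Q x y ->
             u x = 0)
          (u \in UTnn Q lam).
Proof.
rewrite [u \in UTnn _ _]inE; apply: (iffP andP) => -[uQ h]; split=> //.
  move=> x y xQ yl xy; apply/eqP; apply: (implyP (forall_inP h x xQ)).
  by apply/exists_inP; exists y.
apply/forall_inP=> x xQ; apply/implyP=> /exists_inP[y yl xy].
by apply/eqP/(h x y).
Qed.

Lemma UTnn_group_set Q lam : group_set (UTnn Q lam).
Proof.
apply/group_setP; split.
  apply/mem_UTnnP; split=> [|[i j] y]; first exact: group1.
  by rewrite inE /= => /andP[ij _] _ _; rewrite ffunE /= (negPf ij).
move=> u v /mem_UTnnP[uQ hu] /mem_UTnnP[vQ hv].
apply/mem_UTnnP; split=> [|[i k] y]; first exact: groupM.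
rewrite inE /= => /andP[ik hik] yl /andP[/= yi ky].
rewrite ut_mulE_all big1 // => j _.
have [hij|/(mem_UTP _ _ uQ)->] := boolP (ple Q i j); last by rewrite mul0r.
have [hjk|/(mem_UTP _ _ vQ)->] := boolP (ple Q j k); last by rewrite mulr0.
have [eij|nij] := eqVneq i j.
  rewrite (hv (j, k) y) ?mulr0 // -?eij ?inE /plt /= ?ik //.
  by rewrite /ile /= yi ky.
rewrite (hu (i, j) y) ?mul0r // ?inE /plt /= ?nij //.
by rewrite /ile /= yi (ple_trans hjk ky).
Qed.

Canonical UTnn_group Q lam := Group (UTnn_group_set Q lam).

Definition chi Q lam : 'CF(UT Q) :=
  \sum_(i : Iirr (UT Q) |
          (UTnn Q lam \subset cfker 'chi_i) &&
          [forall O : {set ut F R},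
             NPtt_cover Q (UTnn Q lam) O ==> ~~ (O \subset cfker 'chi_i)])
    'chi_i 1%g *: 'chi_i.

End Supercharacters.

Arguments UT F {B} R Q.
Arguments NPtt F {B} R Q.
Arguments UTnn F {B} R Q lam.
Arguments chi F {B} R Q lam.

(* Main.v *)
(* Since UT_P is normal in UT_Q exactly when the complement of P is a         *)
(* down-set of Int0 Q, every irreducible character 'chi_i of UT_Q has a least *)
(* down-set K_i whose vanishing subgroup lies in its kernel, and chi Q nu is  *)
(* the sum of 'chi_i(1) 'chi_i over the i for which K_i is the down-set       *)
(* generated by nu. For a down-set E and a set T of maximal elements of E,    *)
(* the sum of 'chi_i(1) 'chi_i(u) over T <= K_i <= E is computed by removing  *)
(* elements of T one at a time: with q = #|F| it is q^|E \ T| times the       *)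
(* product over x in T of q [u_x = 0] - 1 if u vanishes on E \ T, and 0       *)
(* otherwise. Both sides of the theorem are such sums: chi R lam has E the    *)
(* down-set of lam and T = lam, the right-hand sum has E :&: Int0 Q and       *)
(* T = lam_Q, and the two values differ by a constant.                        *)
Require Import Defs.
From mathcomp Require Import all_boot all_order all_fingroup all_algebra.
From mathcomp Require Import all_solvable all_field all_character.
From mathcomp Require Import ring.
Set Implicit Arguments.
Unset Strict Implicit.
Unset Printing Implicit Defensive.
Import GroupScope GRing.Theory.
Local Open Scope ring_scope.

(** Both sides are evaluated at an element u of UT_Q; write q = #|F|. Normal pattern subgroups
    correspond, with inclusion reversed, to down-sets of intervals ([NPttP], [UTnn_subset]), and
    those inside a given kernel are closed under products ([UTnnI_sub]). So each irreducible has a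
    least down-set [ker_downset i] and occurs in exactly one supercharacter ([chi_ker_downset],
    [sum_chi_ker_downset]). The irreducibles trivial on a normal subgroup add up to an inflated
    regular character ([sum_irr_sub_cfker]); inclusion-exclusion over maximal intervals then gives
    explicit values ([sum_ker_downset], [chiE]).

    Let D be the down-set of lam in R and E its part in Q. An element of UT_Q vanishes on D outside
    Q, so vanishing on D minus lam amounts to vanishing on E minus lam_Q, and each interval of lam
    outside Q contributes a constant factor q - 1. The right-hand sum runs over the down-sets
    between lam_Q and E, so its value has the same shape; the degrees ([chi1E]) and the index
    ([index_UTnn]) account for the remaining powers of q and q - 1. *)

(** These irreducibles are the inflations from G / N, so the sum is the regular character of G / N,
    inflated. *)
Lemma sum_irr_sub_cfker (gT : finGroupType) (G N : {group gT}) (g : gT) :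
  N <| G -> g \in G ->
  (\sum_(i : Iirr G | N \subset cfker 'chi_i) 'chi_i 1%g *: 'chi_i) g
    = #|G : N|%:R *+ (g \in N).
Proof.
move=> nsNG Gg; rewrite sum_cfunE (reindex _ (mod_Iirr_bij nsNG)) /=.
transitivity (cfReg (G / N) (coset N g)).
  rewrite cfReg_sum sum_cfunE; apply: eq_big => [i | i _].
    by rewrite mod_IirrE ?cfker_mod.
  by rewrite !cfunE mod_IirrE // !cfModE // coset_id.
have Ng := subsetP (normal_norm nsNG) g Gg.
rewrite cfRegE card_quotient ?normal_norm //; congr (_ *+ nat_of_bool _).
by apply/eqP/idP => [/(coset_idr Ng) | /coset_id].
Qed.

(** * Down-sets of intervals and their antichains of maximal elements *)

Section DownSets.
Variable B : finType.
Implicit Types (Q : poset B) (E lam : {set B * B}) (x y : B * B).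

Definition downset Q E : bool :=
  (E \subset Int0 Q) &&
  [forall x in Int0 Q, forall y in E, ile Q x y ==> (x \in E)].

Definition down Q lam : {set B * B} :=
  [set x in Int0 Q | [exists y in lam, ile Q x y]].

Definition maxels Q E : {set B * B} :=
  [set x in E | [forall y in E, ile Q x y ==> (x == y)]].

Lemma ile_refl Q : reflexive (ile Q).
Proof. by move=> x; rewrite /ile !ple_refl. Qed.

Lemma ile_trans Q : transitive (ile Q).
Proof.
move=> y x z /andP[xy1 xy2] /andP[yz1 yz2].
by rewrite /ile (ple_trans yz1 xy1) (ple_trans xy2 yz2).
Qed.

Lemma ile_anti Q : antisymmetric (ile Q).
Proof.
move=> [x1 x2] [y1 y2]; rewrite /ile /= => /andP[/andP[h1 h2] /andP[h3 h4]].
by congr (_, _); apply: (@ple_anti _ Q); apply/andP.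
Qed.

Lemma downsetP Q E :
  reflect (E \subset Int0 Q /\
           forall x y, x \in Int0 Q -> y \in E -> ile Q x y -> x \in E)
          (downset Q E).
Proof.
apply: (iffP andP) => -[sE h]; split=> //.
  by move=> x y xQ yE; apply/implyP; apply: (forall_inP (forall_inP h x xQ)).
by apply/forall_inP=> x xQ; apply/forall_inP=> y yE; apply/implyP; apply: h.
Qed.

Lemma downset_Int0 Q E : downset Q E -> E \subset Int0 Q.
Proof. by case/andP. Qed.

Lemma downsetT Q : downset Q (Int0 Q).
Proof. by apply/downsetP; split. Qed.

Lemma downsetI Q E1 E2 :
  downset Q E1 -> downset Q E2 -> downset Q (E1 :&: E2).
Proof.
move=> /downsetP[s1 d1] /downsetP[s2 d2]; apply/downsetP; split.
  by rewrite (subset_trans _ s1) ?subsetIl.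
by move=> x y xQ /setIP[y1 y2] xy; rewrite inE (d1 x y) ?(d2 x y).
Qed.

Lemma downsetU Q E1 E2 :
  downset Q E1 -> downset Q E2 -> downset Q (E1 :|: E2).
Proof.
move=> /downsetP[s1 d1] /downsetP[s2 d2]; apply/downsetP; split.
  by rewrite subUset s1.
move=> x y xQ /setUP[yE|yE] xy; apply/setUP; [left|right].
  exact: (d1 x y).
exact: (d2 x y).
Qed.

Lemma downset_down Q lam : downset Q (down Q lam).
Proof.
apply/downsetP; split=> [|x y xQ]; first by apply/subsetP=> x; rewrite inE => /andP[].
rewrite inE => /andP[_ /exists_inP[z zl yz]] xy; rewrite inE xQ.
by apply/exists_inP; exists z; rewrite // (ile_trans xy yz).
Qed.

Lemma sub_down Q lam : lam \subset Int0 Q -> lam \subset down Q lam.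
Proof.
move=> sl; apply/subsetP=> x xl; rewrite inE (subsetP sl) //=.
by apply/exists_inP; exists x; rewrite ?ile_refl.
Qed.

Lemma down_subset Q lam E : downset Q E -> lam \subset E -> down Q lam \subset E.
Proof.
move=> /downsetP[_ dE] sl; apply/subsetP=> x; rewrite inE.
by case/andP=> xQ /exists_inP[y yl]; apply: dE => //; apply: (subsetP sl).
Qed.

Lemma downset_setD1 Q E x :
  downset Q E -> x \in maxels Q E -> downset Q (E :\ x).
Proof.
move=> /downsetP[sE dE]; rewrite inE => /andP[xE /forall_inP mx].
apply/downsetP; split=> [|z y zQ]; first by rewrite (subset_trans _ sE) ?subsetDl.
rewrite !inE => /andP[yx yE] zy; rewrite (dE z y) // andbT.
apply: contraNneq yx => zx; rewrite zx in zy.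
by rewrite eq_sym (implyP (mx y yE) zy).
Qed.

Lemma maxels_ppnn Q E : E \subset Int0 Q -> maxels Q E \in ppnn Q.
Proof.
move=> sE; rewrite inE; apply/andP; split.
  by apply/subsetP=> x; rewrite inE => /andP[/(subsetP sE)].
apply/forall_inP=> x; rewrite inE => /andP[_ /forall_inP mx].
by apply/forall_inP=> y; rewrite inE => /andP[yE _]; apply: mx.
Qed.

Lemma down_maxels Q E : downset Q E -> down Q (maxels Q E) = E.
Proof.
move=> dE; have [sE _] := downsetP _ _ dE.
apply/eqP; rewrite eqEsubset down_subset //=; last first.
  by apply/subsetP=> x; rewrite inE => /andP[].
apply/subsetP=> x xE; rewrite inE (subsetP sE) //=.
pose up z := #|[set y in E | ile Q z y]|.
(* Among the elements of [E] above [x], one with the fewest elements of [E] above it is maximal. *)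
have: (x \in E) && ile Q x x by rewrite xE ile_refl.
case/(@arg_minnP _ _ (fun z => (z \in E) && ile Q x z) up) => z /andP[zE xz] min_z.
apply/exists_inP; exists z => //; rewrite inE zE.
apply/forall_inP=> y yE; apply/implyP=> zy; apply/eqP/(@ile_anti Q); rewrite zy /=.
have := min_z y; rewrite yE (ile_trans xz zy) => /(_ isT).
rewrite /up => le_zy; have/eqP eyz: [set w in E | ile Q y w] == [set w in E | ile Q z w].
  rewrite eqEcard le_zy andbT; apply/subsetP=> w; rewrite !inE => /andP[-> yw].
  exact: (ile_trans zy yw).
have : z \in [set w in E | ile Q z w] by rewrite inE zE ile_refl.
by rewrite -eyz inE => /andP[].
Qed.

Lemma maxels_down Q lam : lam \in ppnn Q -> maxels Q (down Q lam) = lam.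
Proof.
rewrite inE => /andP[sl /forall_inP al]; have sd := sub_down sl.
apply/setP=> x; rewrite inE; apply/andP/idP => [[]|xl].
  rewrite inE => /andP[_ /exists_inP[y yl xy]] /forall_inP/(_ y (subsetP sd y yl)).
  by rewrite xy => /eqP->.
split; first exact: (subsetP sd).
apply/forall_inP=> y; rewrite inE => /andP[yQ /exists_inP[z zl yz]].
apply/implyP=> xy; have/eqP xz := implyP (forall_inP (al x xl) z zl) (ile_trans xy yz).
by apply/eqP/(@ile_anti Q); rewrite xy xz.
Qed.

End DownSets.

(** * Normal pattern subgroups of UT_Q and down-sets of [Int0 Q] *)

Section PatternSubgroups.
Variables (F : finFieldType) (B : finType) (R Q : poset B).
Hypothesis sQR : subposet Q R.
Implicit Types (E lam : {set B * B}) (x y : B * B) (u v w : ut F R).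
Local Notation V := (UTnn F R Q).

Lemma UTnn_down lam : V lam = V (down Q lam).
Proof.
apply/setP=> u; apply/mem_UTnnP/mem_UTnnP=> -[uQ h]; split=> // x y xQ.
  rewrite inE => /andP[_ /exists_inP[z zl yz]] xy.
  exact: (h x z xQ zl (ile_trans xy yz)).
move=> yl xy; apply: (h x x) => //; last exact: ile_refl.
by rewrite inE xQ; apply/exists_inP; exists y.
Qed.

Lemma mem_UTnn_downsetP E u :
  downset Q E -> reflect (u \in UT F R Q /\ {in E, forall x, u x = 0}) (u \in V E).
Proof.
move=> /downsetP[sE dE]; apply: (iffP (mem_UTnnP _ _ _)) => -[uQ h]; split=> //.
  by move=> x xE; apply: (h x x); rewrite ?(subsetP sE) ?ile_refl.
by move=> x y xQ yE xy; apply/h/(dE x y).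
Qed.

(** The entry of a product at [i, k] involves only diagonal entries and entries at subintervals of
    [i, k]. Thus restriction to a down-set is compatible with multiplication, which is why [V E] is
    normal. *)
Lemma ut_mul_eq_on E (u u' v v' : ut F R) :
    downset Q E -> u \in UT F R Q -> u' \in UT F R Q ->
    v \in UT F R Q -> v' \in UT F R Q ->
    {in E, u =1 u'} -> {in E, v =1 v'} ->
  {in E, (u * v)%g =1 (u' * v')%g}.
Proof.
move=> /downsetP[sE dE] /mem_UTP uQ /mem_UTP uQ' /mem_UTP vQ /mem_UTP vQ' hu hv.
move=> [i k] ikE; rewrite !ut_mulE_all; apply: eq_bigr => j _.
have [ij|nij] := boolP (ple Q i j); last by rewrite uQ // uQ' // !mul0r.
have [jk|njk] := boolP (ple Q j k); last by rewrite vQ // vQ' // !mulr0.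
congr (_ * _).
  have [->|ne] := eqVneq i j; first by rewrite !ut_diag.
  by apply/hu/(dE _ (i, k)); rewrite // ?inE /plt /= ?ne // /ile ple_refl.
have [->|ne] := eqVneq j k; first by rewrite !ut_diag.
by apply/hv/(dE _ (i, k)); rewrite // ?inE /plt /= ?ne // /ile /= ple_refl ij.
Qed.

Lemma UTnn_normal lam : V lam <| UT F R Q.
Proof.
rewrite UTnn_down; move: (down Q lam) (downset_down Q lam) => E dD.
have sVQ : V E \subset UT F R Q by apply/subsetP=> u /mem_UTnnP[].
apply/andP; split=> //; apply/normsP=> v vQ; apply/eqP; rewrite eqEcard cardJg leqnn andbT.
apply/subsetP=> _ /imsetP[u uV ->]; have uQ := subsetP sVQ u uV.
have [_ uE] := mem_UTnn_downsetP _ dD uV.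
apply/mem_UTnn_downsetP => //; split=> [|x xE]; first by rewrite !groupM ?groupV.
have off1 : {in E, u =1 (1%g : ut F R)}.
  move=> y yE; rewrite uE //= ffunE.
  have := subsetP (downset_Int0 dD) y yE.
  by rewrite inE /plt => /andP[/negPf->].
have off1v : {in E, (u * v)%g =1 (1 * v)%g}.
  by apply: ut_mul_eq_on; rewrite ?group1.
rewrite conjgE (ut_mul_eq_on (u' := v^-1%g) (v' := (1 * v)%g) dD) ?groupM ?groupV ?group1 //.
rewrite mul1g mulVg /= ffunE.
by have := subsetP (downset_Int0 dD) x xE; rewrite inE /plt => /andP[/negPf->].
Qed.

(** The elementary matrix 1 + e_x. The default of [insubd] is reached only when [x] is not in
    [Int0 R]. *)
Definition transv x : ut F R :=
  insubd (ut_one F R) [ffun y => (y.1 == y.2)%:R + (y == x)%:R].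

Lemma transvE x y : x \in Int0 R -> transv x y = (y.1 == y.2)%:R + (y == x)%:R.
Proof.
case: x => k l; rewrite inE /plt /= => /andP[kl klR].
rewrite val_insubd ifT ?ffunE //; apply/andP; split.
  apply/forallP=> i; rewrite ffunE eqxx xpair_eqE /=.
  by have [->|_] := eqVneq i k; rewrite ?(negPf kl) addr0.
apply/forallP=> -[i j]; apply/implyP=> ij; rewrite ffunE xpair_eqE /=.
have /negPf-> : i != j by apply: contraNneq ij => ->; apply: ple_refl.
have [ei|_] := eqVneq i k; last by rewrite addr0.
by have [ej|_] := eqVneq j l; [case/negP: ij; rewrite ei ej|rewrite addr0].
Qed.

Lemma Int0_sub : Int0 Q \subset Int0 R.
Proof.
apply/subsetP=> -[i j]; rewrite !inE /plt => /andP[-> ij].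
by apply: (subposetP _ _ sQR).
Qed.

Lemma transv_UT (P : poset B) x :
  subposet P R -> x \in Int0 P -> transv x \in UT F R P.
Proof.
move=> /subposetP sPR; case: x => k l; rewrite inE /plt => /andP[/= kl klP].
apply/mem_UTP=> i j nij; rewrite transvE ?inE /plt /= ?kl ?sPR //.
have /negPf-> : i != j by apply: contraNneq nij => ->; apply: ple_refl.
by have [[ei ej]|_] := eqVneq (i, j) (k, l); [case/negP: nij; rewrite ei ej|rewrite addr0].
Qed.

Lemma UTnn_subset E1 E2 :
  downset Q E1 -> downset Q E2 -> (V E1 \subset V E2) = (E2 \subset E1).
Proof.
move=> d1 d2; apply/subsetP/subsetP => [h x xE | h u]; last first.
  move=> /(mem_UTnn_downsetP _ d1)[uQ uE].
  by apply/mem_UTnn_downsetP => //; split=> // x /h; apply: uE.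
(* If [x] is in [E2] but not in [E1], the transvection at [x] separates [V E1] from [V E2]. *)
have xQ := subsetP (downset_Int0 d2) x xE; have xR := subsetP Int0_sub x xQ.
apply: contraTT isT => xE1.
have /h/(mem_UTnn_downsetP _ d2)[_ /(_ x xE)/eqP] : transv x \in V E1.
  apply/mem_UTnn_downsetP => //; split=> [|y yE]; first exact: transv_UT.
  rewrite transvE // (negPf (memPn xE1 y yE)) addr0.
  by have := subsetP (downset_Int0 d1) y yE; rewrite inE /plt => /andP[/negPf->].
rewrite transvE // eqxx; move: xQ; rewrite inE /plt => /andP[/negPf-> _].
by rewrite add0r oner_eq0.
Qed.

Lemma UTnn_NPtt lam : V lam \in NPtt F R Q.
Proof.
rewrite UTnn_down; move: (down Q lam) (downset_down Q lam) => E dE.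
have [sE hE] := downsetP _ _ dE.
have hP : is_partial_order (Q :\: E).
  apply/and3P; split.
  - apply/forallP=> i; rewrite inE -/(ple Q i i) ple_refl andbT.
    by apply/negP=> /(subsetP sE); rewrite inE /plt eqxx.
  - apply/forallP=> i; apply/forallP=> j; apply/implyP; rewrite !inE.
    case/andP=> /andP[_ ij] /andP[_ ji]; apply/eqP/(@ple_anti _ Q).
    by rewrite /ple ij ji.
  apply/forallP=> i; apply/forallP=> j; apply/forallP=> k; apply/implyP.
  rewrite !inE => /andP[/andP[ijE ij] /andP[jkE jk]].
  rewrite -/(ple Q i k) (ple_trans ij jk) andbT.
  have [eij|nij] := eqVneq i j; first by rewrite eij.
  (* Removing a down-set keeps transitivity: were [i, k] in [E], its subinterval [i, j] would be
     too. *)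
  apply: contra ijE => ikE; apply: (hE _ (i, k)); rewrite // ?inE /plt /= ?nij //.
  by rewrite /ile ple_refl.
have eP : UT F R (Poset hP) = V E.
  apply/setP=> u; apply/mem_UTP/(mem_UTnn_downsetP _ dE) => [uP | [/mem_UTP uQ uE] i j].
    split; first by apply/mem_UTP=> i j ij; apply: uP; rewrite /ple inE negb_and orbC ij.
    by move=> [i j] ijE; apply: uP; rewrite /ple inE ijE.
  by rewrite /ple inE negb_and negbK => /orP[/uE|/uQ].
rewrite -eP; apply: imset_f; rewrite inE eP UTnn_normal andbT.
by apply/subsetP=> x; rewrite inE => /andP[].
Qed.

Lemma transv_mul x u i l : x \in Int0 R ->
  (transv x * u)%g (i, l) = u (i, l) + (i == x.1)%:R * u (x.2, l).
Proof.
move=> xR; rewrite ut_mulE_all.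
under eq_bigr do rewrite transvE // mulrDl.
rewrite big_split /=; congr (_ + _).
  by rewrite (bigD1 i) //= eqxx mul1r big1 ?addr0 // => j /negPf; rewrite eq_sym => ->; rewrite mul0r.
case: x xR => k m _; rewrite (bigD1 m) //= xpair_eqE eqxx andbT big1 ?addr0 // => j /negPf jm.
by rewrite xpair_eqE jm andbF mul0r.
Qed.

Lemma mul_transv x u i l : x \in Int0 R ->
  (u * transv x)%g (i, l) = u (i, l) + (l == x.2)%:R * u (i, x.1).
Proof.
move=> xR; rewrite ut_mulE_all.
under eq_bigr do rewrite transvE // mulrDr.
rewrite big_split /=; congr (_ + _).
  by rewrite (bigD1 l) //= eqxx mulr1 big1 ?addr0 // => j /negPf ->; rewrite mulr0.
case: x xR => k m _; rewrite (bigD1 k) //= xpair_eqE eqxx mulrC big1 ?addr0 // => j /negPf jm.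
by rewrite xpair_eqE jm mulr0.
Qed.

(* Conjugating the transvection at [k, l] by those at [i, k] and [l, j] makes *)
(* the entry at [i, j] nonzero.                                               *)
Lemma normal_UT_ile (P : poset B) x y :
    subposet P Q -> UT F R P <| UT F R Q -> y \in Int0 Q ->
  x \in Int0 P -> ile Q x y -> y \in (P : {set B * B}).
Proof.
move=> sPQ nP; have sPR : subposet P R := subset_trans sPQ sQR.
have nPa a : a \in UT F R Q -> a \in 'N(UT F R P) by apply/subsetP/normal_norm.
case: x y => [k l] [i j] ijQ klP /andP[/= ik lj].
have /andP[/= kl klP'] : plt P k l by rewrite inE in klP.
have klQ : ple Q k l by apply: (subposetP _ _ sPQ).
have lt_il : i != l.
  apply: contraNneq kl => eil; apply/eqP/(@ple_anti _ Q).
  by rewrite klQ -eil ik.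
have ilP : ple P i l.
  have [->//|nik] := eqVneq i k; apply: contraTT isT => nil.
  have ikQ : (i, k) \in Int0 Q by rewrite inE /plt nik.
  (* The entry at [i, l] is 1 on the left, but on the right it is that of [w], which vanishes when
     [i, l] is outside [P]. *)
  have [w wP e] : exists2 w, w \in UT F R P & (transv (i, k) * transv (k, l) = w * transv (i, k))%g.
    exists (transv (k, l) ^ (transv (i, k))^-1)%g; last by rewrite conjgE invgK !mulgA mulgKV.
    by rewrite memJ_norm ?groupV ?nPa ?transv_UT.
  have := congr1 (fun v : ut F R => v (i, l)) e.
  rewrite /= transv_mul ?mul_transv ?(subsetP Int0_sub) //= !transvE /=; last 2 first.
  - by rewrite (subsetP Int0_sub) // inE /plt kl.
  - by rewrite (subsetP Int0_sub) // inE /plt kl.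
  rewrite !eqxx !xpair_eqE eqxx (negPf nik) (negPf lt_il) (negPf kl) eq_sym (negPf kl).
  rewrite (mem_UTP _ _ wP _ _ nil) !(mul0r, add0r, addr0, mul1r).
  by move/eqP; rewrite ?oner_eq0.
have [<-//|nlj] := eqVneq l j; apply: contraTT isT => nij.
have ljQ : (l, j) \in Int0 Q by rewrite inE /plt nlj.
have ilI : (i, l) \in Int0 P by rewrite inE /plt lt_il.
have ilR : (i, l) \in Int0 R.
  by rewrite inE /plt lt_il; apply: (subposetP _ _ sPR).
have [w wP e] : exists2 w, w \in UT F R P & (transv (i, l) * transv (l, j) = transv (l, j) * w)%g.
  exists (transv (i, l) ^ transv (l, j))%g; last by rewrite conjgE mulKVg.
  by rewrite memJ_norm ?nPa ?transv_UT.
have := congr1 (fun v : ut F R => v (i, j)) e.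
rewrite /= !transv_mul ?(subsetP Int0_sub) //=; last first.
  by rewrite inE /plt lt_il (ple_trans ik klQ).
rewrite !transvE ?(subsetP Int0_sub) //=.
have /andP[/negPf /= nij' _] : plt Q i j by rewrite inE in ijQ.
rewrite !eqxx !xpair_eqE eqxx nij' (negPf lt_il) (negPf nlj).
rewrite (mem_UTP _ _ wP _ _ nij) !(mul0r, add0r, addr0, mul1r).
by move/eqP; rewrite ?oner_eq0.
Qed.

Lemma NPttP N :
  reflect (exists2 E, downset Q E & N = V E) (N \in NPtt F R Q).
Proof.
apply: (iffP idP) => [|[E _ ->]]; last exact: UTnn_NPtt.
case/imsetP=> P; rewrite inE => /andP[sPQ nP] ->.
have dE : downset Q (Int0 Q :\: P).
  apply/downsetP; split=> [|x y xQ]; first exact: subsetDl.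
  rewrite !inE => /andP[yP yQ] xy; apply/andP; split; last by rewrite inE in xQ.
  apply: contra yP => xP; apply: (normal_UT_ile sPQ nP (x := x)) => //.
    by rewrite inE.
  by rewrite inE /plt /ple -surjective_pairing xP andbT; move: xQ; rewrite inE => /andP[].
exists (Int0 Q :\: P) => //; apply/setP=> u.
apply/mem_UTP/(mem_UTnn_downsetP _ dE) => [uP | [/mem_UTP uQ uE] i j ijP].
  split=> [|[i j]]; last by rewrite !inE => /andP[/uP].
  by apply/mem_UTP=> i j ij; apply: uP; apply: contra ij; apply: (subposetP _ _ sPQ).
have [ijQ|/uQ//] := boolP (ple Q i j).
apply: uE; rewrite !inE ijP /plt ijQ andbT.
by apply: contraNneq ijP => /= ->; apply: ple_refl.
Qed.

(** The entries on [Int0 Q :\: E] are free and determine the element; [f] erases the diagonal so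
    that the image is exactly the functions supported there. *)
Lemma card_UTnn E : downset Q E -> #|V E| = (#|F| ^ #|Int0 Q :\: E|)%N.
Proof.
move=> dE; pose f (u : ut F R) : {ffun B * B -> F} := [ffun x => (x.1 != x.2)%:R * u x].
have f_inj : injective f.
  move=> u v /ffunP e; apply: ut_ext => i j; have := e (i, j); rewrite !ffunE /=.
  by have [->|_] := eqVneq i j; rewrite ?ut_diag // !mul1r.
rewrite -(card_pffun_on 0 (Int0 Q :\: E) F) -(card_imset _ f_inj); apply: eq_card => g.
apply/imsetP/pffun_onP => [[u /(mem_UTnn_downsetP _ dE)[/mem_UTP uQ uE] ->] | [/subsetP sg _]].
  split=> //; apply/subsetP=> -[i j]; rewrite !inE ffunE /= => nz.
  apply/and3P; split; first by apply: contra nz => /uE->; rewrite mulr0.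
    by apply: contra nz => ->; rewrite mul0r.
  by apply: contraNT nz => /uQ->; rewrite mulr0.
have g0 x : x \notin Int0 Q :\: E -> g x = 0 by move=> xE; apply: contraNeq xE; apply: sg.
pose h : {ffun B * B -> F} := [ffun x => (x.1 == x.2)%:R + g x].
have gii i : g (i, i) = 0 by apply: g0; rewrite !inE /plt eqxx andbF.
have gout i j : ~~ ple Q i j -> (i == j)%:R + g (i, j) = 0.
  move=> nij; rewrite g0 ?addr0; last by rewrite !inE /plt (negPf nij) !andbF.
  by have [e|//] := eqVneq i j; rewrite e ple_refl in nij.
have hut : is_ut R h.
  apply/andP; split; first by apply/forallP=> i; rewrite ffunE eqxx gii addr0.
  apply/forallP=> -[i j]; apply/implyP=> nij; rewrite ffunE gout //.
  by apply: contra nij; apply: (subposetP _ _ sQR).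
exists (Ut hut).
  apply/mem_UTnn_downsetP => //; split; first by apply/mem_UTP=> i j /gout; rewrite ffunE.
  move=> x xE; rewrite ffunE g0 ?inE ?xE // addr0.
  by have := subsetP (downset_Int0 dE) x xE; rewrite inE /plt => /andP[/negPf->].
apply/ffunP=> -[i j]; rewrite !ffunE /=.
by have [->|_] := eqVneq i j; rewrite ?gii ?mul0r // mul1r add0r.
Qed.

(** * Indices, kernels of irreducibles and supercharacter values *)

Lemma downset0 : downset Q set0.
Proof. by apply/downsetP; split=> [|x y _]; rewrite ?sub0set ?inE. Qed.

Lemma UTnn0 : V set0 = UT F R Q.
Proof.
apply/setP=> u; apply/(mem_UTnn_downsetP _ downset0)/idP => [[]//|uQ].
by split=> // x; rewrite inE.
Qed.

Lemma index_UTnn E1 E2 : downset Q E1 -> downset Q E2 -> E1 \subset E2 ->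
  #|V E1 : V E2| = (#|F| ^ (#|E2| - #|E1|))%N.
Proof.
move=> d1 d2 s12; have [s1 s2] := (downset_Int0 d1, downset_Int0 d2).
have F_gt0 : (0 < #|F|)%N by apply/card_gt0P; exists 0.
rewrite -divgS ?UTnn_subset // !card_UTnn // -expnB //; last first.
  by rewrite subset_leq_card ?setDS.
rewrite !cardsD (setIidPr s1) (setIidPr s2); congr (_ ^ _)%N.
by rewrite subnBA ?subset_leq_card // addnC addnBA ?subset_leq_card // subnAC addnK.
Qed.

(** By counting, [V (E1 :&: E2)] is the product of [V E1] and [V E2], whose intersection is
    [V (E1 :|: E2)]. This is what makes a least down-set exist for each irreducible. *)
Lemma UTnnI_sub (K : {group ut F R}) E1 E2 : downset Q E1 -> downset Q E2 ->
  V E1 \subset K -> V E2 \subset K -> V (E1 :&: E2) \subset K.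
Proof.
move=> d1 d2 s1 s2; have dI := downsetI d1 d2; have dU := downsetU d1 d2.
have -> : V (E1 :&: E2) = (V E1 * V E2)%g; last by rewrite mul_subG.
apply/esym/eqP; rewrite eqEcard; apply/andP; split.
  by rewrite mul_subG // UTnn_subset ?subsetIl ?subsetIr.
have VI : V E1 :&: V E2 = V (E1 :|: E2).
  apply/setP=> u; rewrite inE; apply/andP/(mem_UTnn_downsetP _ dU).
    case=> /(mem_UTnn_downsetP _ d1)[uQ u1] /(mem_UTnn_downsetP _ d2)[_ u2].
    by split=> // x /setUP[/u1|/u2].
  by case=> uQ u12; split; apply/mem_UTnn_downsetP => //; split=> // x xE;
     apply: u12; rewrite inE xE ?orbT.
have F_gt0 : (0 < #|F|)%N by apply/card_gt0P; exists 0.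
have := mul_cardG (V E1) (V E2); rewrite VI !card_UTnn // => e.
rewrite -(leq_pmul2r (m := #|F| ^ #|Int0 Q :\: (E1 :|: E2)|)%N) ?expn_gt0 ?F_gt0 //.
by rewrite -e -!expnD setDIr setDUr cardsUI.
Qed.

(* The complement of the largest normal pattern subgroup in the kernel of     *)
(* 'chi_i.                                                                    *)
Definition ker_downset (i : Iirr (UT F R Q)) : {set B * B} :=
  Int0 Q :&: \bigcap_(E | downset Q E && (V E \subset cfker 'chi_i)) E.

Lemma ker_downsetP (i : Iirr (UT F R Q)) :
  downset Q (ker_downset i) /\ V (ker_downset i) \subset cfker 'chi_i.
Proof.
pose K A := downset Q A && (V A \subset cfker 'chi_i).
suffices /andP[] : K (ker_downset i) by [].
(* [Int0 Q] is carried through the induction because the empty intersection is the full set of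
   pairs; the base case is then the trivial subgroup [V (Int0 Q)]. *)
rewrite /ker_downset; apply: (big_ind (fun A => K (Int0 Q :&: A))).
- rewrite setIT /K downsetT; apply/subsetP=> u /(mem_UTnn_downsetP _ (downsetT Q))[/mem_UTP uQ u0].
  suffices -> : u = 1%g by rewrite group1.
  apply: ut_ext => k l; rewrite [RHS]ffunE /=.
  have [->|nkl] := eqVneq k l; first by rewrite ut_diag.
  have [kl|/uQ//] := boolP (ple Q k l).
  by apply: u0; rewrite inE /plt nkl.
- move=> A1 A2 /andP[d1 k1] /andP[d2 k2]; rewrite /K setIIr downsetI //=.
  exact: UTnnI_sub.
by move=> E /andP[dE kE]; rewrite (setIidPr (downset_Int0 dE)) /K dE.
Qed.

Lemma UTnn_sub_cfker (i : Iirr (UT F R Q)) E : downset Q E ->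
  (V E \subset cfker 'chi_i) = (ker_downset i \subset E).
Proof.
have [dk sk] := ker_downsetP i; move=> dE; apply/idP/idP => [kE | sE].
  by apply: subset_trans (subsetIr _ _) _; apply: bigcap_inf; rewrite dE.
by apply: subset_trans sk; rewrite UTnn_subset.
Qed.

Lemma chi_ker_downset lam :
  chi F R Q lam = \sum_(i | ker_downset i == down Q lam) 'chi_i 1%g *: 'chi_i.
Proof.
have dD := downset_down Q lam; rewrite /chi UTnn_down; apply: eq_bigl => i.
have [dk sk] := ker_downsetP i; rewrite UTnn_sub_cfker //.
apply/andP/eqP => [[sD /forallP noO] | eD].
  apply/eqP; rewrite eqEsubset sD /=; apply: contraTT isT => nsD.
  (* If [ker_downset i] is strictly smaller, a smallest normal pattern subgroup strictly above
     [V (down Q lam)] and inside [V (ker_downset i)] is a cover lying in the kernel. *)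
  pose P O := [&& O \in NPtt F R Q, V (down Q lam) \proper O & O \subset V (ker_downset i)].
  have P0 : P (V (ker_downset i)).
    by rewrite /P UTnn_NPtt subxx properE !UTnn_subset // sD (negPf nsD).
  case: (arg_minnP (fun O : {set ut F R} => #|O|) P0) => O /and3P[OQ pO sO] minO.
  have /implyP/(_ _)/negP[] := noO O; last exact: subset_trans sk.
  rewrite /NPtt_cover OQ pO; apply/forall_inP=> N NQ; apply/negP=> /andP[DN NO].
  have := proper_card NO; rewrite ltnNge minO //.
  by rewrite /P NQ DN (subset_trans (proper_sub NO)).
rewrite eD; split=> //; apply/forallP=> O; apply/implyP=> /and3P[/NPttP[E dE ->] pE _].
rewrite UTnn_sub_cfker // eD -UTnn_subset //.
by case/andP: pE.
Qed.

(** Each irreducible occurs for a single antichain, the maximal elements of its [ker_downset]. *)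
Lemma sum_chi_ker_downset (P : pred {set B * B}) :
  \sum_(nu in ppnn Q | P (down Q nu)) chi F R Q nu
    = \sum_(i | P (ker_downset i)) 'chi_i 1%g *: 'chi_i.
Proof.
under eq_bigr do rewrite chi_ker_downset.
rewrite (exchange_big_dep (fun i => P (ker_downset i))) /=; last first.
  by move=> nu i /andP[_ Pnu] /eqP->.
apply: eq_bigr => i Pi; have [dk _] := ker_downsetP i.
rewrite (big_pred1 (maxels Q (ker_downset i))) // => nu /=.
apply/idP/eqP => [/andP[/andP[nuQ _] /eqP->] | ->]; first by rewrite maxels_down.
by rewrite maxels_ppnn ?downset_Int0 // down_maxels // Pi eqxx.
Qed.

(** Induction on [T]. For x in [T], the down-sets between [T :\ x] and [E] that miss x are those
    between [T :\ x] and [E :\ x], so the sum for (E, T) is a difference of two sums with one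
    constraint fewer. For empty [T] it is the inflated regular character of UT_Q / V E. *)
Lemma sum_ker_downset E (T : {set B * B}) (u : ut F R) :
    downset Q E -> T \subset maxels Q E -> u \in UT F R Q ->
  (\sum_(i | (T \subset ker_downset i) && (ker_downset i \subset E))
     'chi_i 1%g *: 'chi_i) u
    = (#|F| ^ #|E :\: T| * [forall x in E :\: T, u x == 0])%:R
        * \prod_(x in T) (#|F|%:R *+ (u x == 0) - 1) :> algC.
Proof.
move=> dE sT uQ; have [n] := ubnP #|T|; elim: n => // n IHn in E T dE sT *.
rewrite ltnS => leTn; have [->|[x xT]] := set_0Vmem T.
  rewrite big_set0 mulr1 setD0.
  rewrite (eq_bigl (fun i => V E \subset cfker 'chi_i)); last first.
    by move=> i; rewrite sub0set UTnn_sub_cfker.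
  have idx : #|UT F R Q : V E| = (#|F| ^ #|E|)%N.
    by rewrite -UTnn0 index_UTnn ?downset0 ?sub0set // cards0 subn0.
  rewrite sum_irr_sub_cfker ?UTnn_normal // idx natrM mulr_natr; congr (_ *+ nat_of_bool _).
  apply/(mem_UTnn_downsetP _ dE)/forall_inP => [[_ h] y /h->//|h].
  by split=> // y /h/eqP.
have xm := subsetP sT x xT; have xE : x \in E by move: xm; rewrite inE => /andP[].
have dEx := downset_setD1 dE xm.
have ltn : (#|T :\ x| < n)%N by rewrite (cardsD1 x T) xT in leTn.
have sT1 : T :\ x \subset maxels Q E by rewrite (subset_trans (subsetDl _ _)).
have sT2 : T :\ x \subset maxels Q (E :\ x).
  apply/subsetP=> y yT; have := subsetP sT1 y yT; rewrite !inE => /andP[yE /forall_inP my].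
  move: yT; rewrite !inE yE => /andP[-> _] /=; apply/forall_inP=> z.
  by rewrite inE => /andP[_ zE]; apply: my.
have := IHn E (T :\ x) dE sT1 ltn.
rewrite (bigID (fun i => x \in ker_downset i)) /= cfunE.
rewrite [X in _ + fun_of_cfun X _ = _](eq_bigl (fun i =>
  (T :\ x \subset ker_downset i) && (ker_downset i \subset E :\ x))); last first.
  by move=> i; rewrite -andbA subsetD1.
rewrite (IHn (E :\ x) (T :\ x)) // => /(canRL (addrK _)) e.
rewrite (eq_bigl (fun i => (T :\ x \subset ker_downset i) &&
  (ker_downset i \subset E) && (x \in ker_downset i))); last first.
  by move=> i; rewrite -{1}(setD1K xT) subUset sub1set -andbA andbC.
have eT : (E :\ x) :\: (T :\ x) = E :\: T.
  apply/setP=> y; rewrite !inE; have [->|] := eqVneq y x; rewrite ?xT //=.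
have eTx : E :\: (T :\ x) = x |: (E :\: T).
  apply/setP=> y; rewrite !inE; have [->|] := eqVneq y x; rewrite ?xE //=.
have eA : [forall y in x |: (E :\: T), u y == 0] =
    (u x == 0) && [forall y in E :\: T, u y == 0].
  apply/forall_inP/andP => [h | [ux /forall_inP h] y].
    split; first by apply: h; rewrite setU11.
    by apply/forall_inP=> y yE; apply: h; rewrite inE yE orbT.
  by case/setU1P=> [->|/h].
(* The two sums differ by a factor q [u_x = 0] against 1, whose difference is the new factor of the
   product. *)
rewrite eT eTx eA cardsU1 inE xT /= add1n expnS -mulnA in e.
rewrite e [in RHS](big_setD1 x) //= [RHS]mulrA -mulrBl; congr (_ * _).
rewrite -mulnb !natrM; case: (u x == 0); rewrite /= ?mulr1n ?mulr0n; ring.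
Qed.

(** A down-set equals [down Q lam] exactly when it lies between [lam] and [down Q lam], so
    [sum_ker_downset] applies with [T] equal to [lam]. *)
Lemma chiE lam (u : ut F R) : lam \in ppnn Q -> u \in UT F R Q ->
  chi F R Q lam u
    = (#|F| ^ #|down Q lam :\: lam| * [forall x in down Q lam :\: lam, u x == 0])%:R
        * \prod_(x in lam) (#|F|%:R *+ (u x == 0) - 1).
Proof.
move=> lQ uQ; have dD := downset_down Q lam.
have sl : lam \subset Int0 Q by move: lQ; rewrite inE => /andP[].
rewrite -sum_ker_downset ?maxels_down // chi_ker_downset.
congr (fun_of_cfun _ u); apply: eq_bigl => i; have [dk _] := ker_downsetP i.
apply/eqP/andP => [-> | [lk kD]]; first by rewrite sub_down.
by apply/eqP; rewrite eqEsubset kD down_subset.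
Qed.

Lemma chi1E lam : lam \in ppnn Q ->
  chi F R Q lam 1%g = #|F|%:R ^+ #|down Q lam :\: lam| * (#|F|%:R - 1) ^+ #|lam|.
Proof.
move=> lQ; have one0 x : x \in Int0 Q -> (1%g : ut F R) x == 0.
  by rewrite inE /plt ffunE => /andP[/negPf-> _]; rewrite eqxx.
rewrite chiE ?group1 // (_ : [forall x in _, _] = true); last first.
  apply/forall_inP=> x /setDP[xD _].
  exact: one0 (subsetP (downset_Int0 (downset_down Q lam)) x xD).
rewrite muln1 natrX; congr (_ * _); rewrite -prodr_const; apply: eq_bigr => x xl.
by rewrite one0 //; move: lQ; rewrite inE => /andP[/subsetP->].
Qed.

End PatternSubgroups.

(** * The restriction formula *)

Theorem corollary3p6 (F : finFieldType) (B : finType) (R Q : poset B)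
    (lam : {set B * B}) :
  subposet Q R -> lam \in ppnn R ->
  'Res[UT F R Q] (chi F R R lam) =
    (#|(UTnn F R Q (nnrestr Q lam) / (UTnn F R R lam :&: UT F R Q))%g|%:R^-1
       * (chi F R R lam 1%g / chi F R Q (nnrestr Q lam) 1%g))
    *: \sum_(nu in ppnn Q |
               (UTnn F R Q nu \subset UTnn F R Q (nnrestr Q lam)) &&
               (UTnn F R R lam :&: UT F R Q \subset UTnn F R Q nu))
         chi F R Q nu.
Proof.
move=> sQR lR; have sRR : subposet R R by apply: subxx.
have lQ := nnrestr_ppnn sQR lR.
have sUT : UT F R Q \subset UT F R R by rewrite UT_ambient subsetT.
set D := down R lam; set lamQ := nnrestr Q lam in lQ *.
set E := D :&: Int0 Q; set DQ := down Q lamQ.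
have dD : downset R D := downset_down R lam.
have [sDR hD] := downsetP _ _ dD.
have slD : lam \subset D by rewrite sub_down //; move: lR; rewrite inE => /andP[].
have dE : downset Q E.
  apply/downsetP; split=> [|x y xQ]; first exact: subsetIr.
  rewrite !in_setI xQ andbT => /andP[yD _] /andP[yx xy].
  apply: (hD x y) => //; first exact: (subsetP (Int0_sub sQR)).
  by rewrite /ile !(subposetP _ _ sQR).
have dDQ : downset Q DQ := downset_down Q lamQ.
have slE : lamQ \subset E by apply: setSI.
have slDQ : lamQ \subset DQ by apply/sub_down/subsetIr.
have sDQE : DQ \subset E by apply: down_subset.
(* Intervals of [lam] are maximal in [D] for the order of [R], which contains that of [Q]. *)
have slm : lamQ \subset maxels Q E.
  apply/subsetP=> x xl; rewrite inE (subsetP slE) //=; apply/forall_inP=> y yE.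
  apply/implyP=> /andP[yx xy].
  have : x \in maxels R D by rewrite maxels_down //; case/setIP: xl.
  rewrite inE => /andP[_ /forall_inP/(_ y)]; case/setIP: yE => -> _ /(_ isT).
  by rewrite /ile !(subposetP _ _ sQR).
have VE : UTnn F R R lam :&: UT F R Q = UTnn F R Q E.
  rewrite UTnn_down; apply/setP=> u; rewrite inE.
  apply/andP/(mem_UTnn_downsetP _ dE) => [[/(mem_UTnn_downsetP _ dD)[uR uD] uQ] | [uQ uE]].
    by split=> // x /setIP[/uD].
  split=> //; apply/mem_UTnn_downsetP => //; split; first exact: (subsetP sUT).
  move=> x xD; have [xQ|] := boolP (x \in Int0 Q); first by apply: uE; apply/setIP.
  have := subsetP sDR x xD; case: x {xD} => i j; rewrite !inE /plt /= => /andP[-> _] ij.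
  exact: (mem_UTP _ _ uQ).
rewrite VE.
(* The subgroup inclusions say that [down Q nu] lies between [DQ] and [E]; a down-set contains [DQ]
   as soon as it contains [lamQ], which puts the sum in the form of [sum_ker_downset]. *)
pose P (A : {set B * B}) := (lamQ \subset A) && (A \subset E).
rewrite (eq_bigl (fun nu => (nu \in ppnn Q) && P (down Q nu))); last first.
  move=> nu; congr (_ && _); rewrite UTnn_down [UTnn F R Q lamQ]UTnn_down.
  rewrite !UTnn_subset ?downset_down //; congr (_ && _).
  apply/idP/idP => [|h]; first exact: subset_trans.
  by rewrite down_subset ?downset_down.
rewrite sum_chi_ker_downset //.
have -> : #|(UTnn F R Q lamQ / UTnn F R Q E)%g| = (#|F| ^ (#|E| - #|DQ|))%N.
  rewrite card_quotient; first by rewrite UTnn_down index_UTnn.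
  have sV := normal_sub (UTnn_normal F R Q lamQ).
  exact: subset_trans sV (normal_norm (UTnn_normal F R Q E)).
apply/cfun_inP=> u uQ; rewrite cfResE // [RHS]cfunE.
rewrite /P sum_ker_downset // !chi1E // chiE ?(subsetP sUT) // -/D -/DQ.
have -> : [forall x in D :\: lam, u x == 0] = [forall x in E :\: lamQ, u x == 0].
  apply/forall_inP/forall_inP => h x.
    case/setDP=> /setIP[xD xQ] xl; apply/h/setDP; split=> //.
    by apply: contra xl => xl; apply/setIP.
  case/setDP=> xD xl; have [xQ|] := boolP (x \in Int0 Q).
    by apply/h/setDP; split; [apply/setIP | apply: contra xl => /setIP[]].
  have := subsetP sDR x xD; case: x {xl xD} => i j; rewrite !inE /plt /= => /andP[-> _] ij.
  by rewrite (mem_UTP _ _ uQ).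
(* At an interval of [lam] outside [Q] the entry of [u] is 0, so the factor is q - 1. *)
have -> : \prod_(x in lam) (#|F|%:R *+ (u x == 0) - 1)
   = (\prod_(x in lamQ) (#|F|%:R *+ (u x == 0) - 1)) * (#|F|%:R - 1) ^+ #|lam :\: lamQ| :> algC.
  rewrite (big_setID lamQ) /= (setIidPr (subsetIl _ _)) -prodr_const; congr (_ * _).
  apply: eq_bigr => x; rewrite !inE => /andP[xQ xl].
  move: xQ; rewrite xl /=; have := subsetP sDR x (subsetP slD x xl).
  by case: x {xl} => i j; rewrite inE /plt /= => /andP[-> _] /(mem_UTP _ _ uQ)->; rewrite eqxx.
have -> : #|lam| = (#|lamQ| + #|lam :\: lamQ|)%N.
  by rewrite -(cardsID lamQ lam) (setIidPr (subsetIl _ _)).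
(* The index exponent plus the power of q in the degree for [lamQ] is the power of q in the
   right-hand sum. *)
have -> : #|E :\: lamQ| = (#|E| - #|DQ| + #|DQ :\: lamQ|)%N.
  rewrite !cardsD (setIidPr slE) (setIidPr slDQ).
  by rewrite addnBA ?subset_leq_card // subnK ?subset_leq_card.
have F_gt1 := finNzRing_gt1 F.
have q_neq0 : #|F|%:R != 0 :> algC by rewrite Num.Theory.pnatr_eq0 -lt0n ltnW.
have q1_neq0 : #|F|%:R - 1 != 0 :> algC by rewrite subr_eq0 Num.Theory.pnatr_eq1 gtn_eqF.
rewrite !natrM !natrX !exprD.
by field; rewrite !expf_neq0.
Qed.
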